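(* Assume that $c^n\in\mathcal V_c$ satisfies $c_m\le c^n\le c_M$ at every cell center and $\langle c^n,1\rangle=c_t$, where $0<c_m\le c_M$ and $\beta c_M\le\epsilon_0<1$, and that $\lambda>0$ satisfies $$\lambda\geq \frac{\epsilon_0}{(1-\epsilon_0)^2}+\left(\frac{\epsilon_0^2}{(1-\epsilon_0)^4}-2\ln(1-\epsilon_0)\frac{\epsilon_0}{(1-\epsilon_0)^2}\right)^{1/2}.$$ Let $c^{n+1}\in\mathcal V_c$, together with the constant $\mu_e^{n+1}\in\mathbb R$, be the solution of the fully discrete scheme $$\frac{c^{n+1}-c^n}{\tau}-\kappa\bigl(\delta_x^u[\delta_x^c[c^{n+1}]]+\delta_y^v[\delta_y^c[c^{n+1}]]\bigr)+\nu(c^n)c^{n+1}=s_r(c^n)+\mu_e^{n+1},\qquad \langle c^{n+1},1\rangle=c_t ,$$ and suppose that $$\max_{c_m\le c\le c_M}\bigl(c_m\nu(c)-s_r(c)\bigr)\le \mu_e^{n+1}\le \min_{c_m\le c\le c_M}\bigl(c_M\nu(c)-s_r(c)\bigr).$$ Then, for any time step size $\tau>0$, $$F_h(c^{n+1})\le F_h(c^n),\qquad\text{where } F_h(c)=\langle f_b(c),1\rangle+\frac{\kappa}{2}\bigl(\|\delta_x^c[c]\|^2+\|\delta_y^c[c]\|^2\bigr).$$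
   Context: Mesh and operators. $\Omega=[0,l_x]\times[0,l_y]$ with $l_x,l_y>0$ carries a uniform mesh $0=x_0<\dots<x_N=l_x$, $0=y_0<\dots<y_M=l_y$ with $h=x_{i+1}-x_i=y_{j+1}-y_j$, and $x_{i+1/2}=\frac{x_i+x_{i+1}}2$, $y_{j+1/2}=\frac{y_j+y_{j+1}}2$. $\mathcal V_c$ is the space of real functions on the cell centers $(x_{i+1/2},y_{j+1/2})$, $0\le i\le N-1$, $0\le j\le M-1$, with values written $c_{i+1/2,j+1/2}$. $\mathcal V_u$ is the space of real functions on the points $(x_i,y_{j+1/2})$, $0\le i\le N$, $0\le j\le M-1$; $\mathcal V_v$ is the space of real functions on $(x_{i+1/2},y_j)$, $0\le i\le N-1$, $0\le j\le M$. $\mathcal V_u^0\subset\mathcal V_u$ and $\mathcal V_v^0\subset\mathcal V_v$ are the subspaces with zero values at $i\in\{0,N\}$, respectively $j\in\{0,M\}$. For $c\in\mathcal V_c$: $\delta_x^c[c]\in\mathcal V_u^0$ is $\delta_x^c[c]_{i,j+1/2}=(c_{i+1/2,j+1/2}-c_{i-1/2,j+1/2})/h$ for $1\le i\le N-1$ and $0$ for $i\in\{0,N\}$; $\delta_y^c[c]\in\mathcal V_v^0$ is $\delta_y^c[c]_{i+1/2,j}=(c_{i+1/2,j+1/2}-c_{i+1/2,j-1/2})/h$ for $1\le j\le M-1$ and $0$ for $j\in\{0,M\}$ (homogeneous Neumann condition). For $u\in\mathcal V_u$, $v\in\mathcal V_v$: $\delta_x^u[u]_{i+1/2,j+1/2}=(u_{i+1,j+1/2}-u_{i,j+1/2})/h$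 and $\delta_y^v[v]_{i+1/2,j+1/2}=(v_{i+1/2,j+1}-v_{i+1/2,j})/h$. Inner products: $\langle c,c'\rangle=h^2\sum_{i=0}^{N-1}\sum_{j=0}^{M-1}c_{i+1/2,j+1/2}c'_{i+1/2,j+1/2}$ on $\mathcal V_c$; $\langle u,u'\rangle=h^2\sum_{i=1}^{N-1}\sum_{j=0}^{M-1}u_{i,j+1/2}u'_{i,j+1/2}$ on $\mathcal V_u^0$; $\langle v,v'\rangle=h^2\sum_{i=0}^{N-1}\sum_{j=1}^{M-1}v_{i+1/2,j}v'_{i+1/2,j}$ on $\mathcal V_v^0$; in each case $\|\cdot\|^2=\langle\cdot,\cdot\rangle$. Nonlinear functions of elements of $\mathcal V_c$ and products are taken pointwise. Constants. $\kappa>0$, $c_t>0$ (total moles), $\vartheta_0\in\mathbb R$, $R>0$, $T>0$ are given. The Peng-Robinson parameters are $\alpha=\alpha(T)=0.45724\frac{R^2T_c^2}{P_c}[1+m(1-\sqrt{T/T_c})]^2$ and $\beta=0.07780\frac{RT_c}{P_c}>0$, where $T_c,P_c>0$ are the critical temperature and pressure and $m$ is a real number determined by the acentric factor $\omega$: $m=0.37464+1.54226\omega-0.26992\omega^2$ if $\omega\le0.49$, and $m=0.379642+1.485030\omega-0.164423\omega^2+0.016666\omega^3$ if $\omega>0.49$. The bulk Helmholtz free energy density is $$f_b(c)=c\,\vartheta_0+RT\,c\ln(c)-RT\,c\ln(1-\beta c)+\frac{\alpha c}{2\sqrt2\,\beta}\ln\Bigl(\frac{1+(1-\sqrt2)\beta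 c}{1+(1+\sqrt2)\beta c}\Bigr).$$ For $c\in[c_m,c_M]$ define $$G(c)=\sqrt{\lambda c-c\ln(1-\beta c)},\qquad \nu(c)=RT\Bigl(\frac1c+G'(c)^2\Bigr),$$ $$\mu_{\rm attraction}(c)=\frac{\alpha}{2\sqrt2\,\beta}\ln\Bigl(\frac{1+(1-\sqrt2)\beta c}{1+(1+\sqrt2)\beta c}\Bigr)-\frac{\alpha c}{1+2\beta c-(\beta c)^2},$$ $$s_r(c)=-\vartheta_0-RT\ln(c)+RT\bigl(G'(c)^2c-2G(c)G'(c)+\lambda\bigr)-\mu_{\rm attraction}(c).$$ The number $\mu_e^{n+1}$ is constant over the mesh and is part of the unknowns of the scheme. *)

(* Defs.v *)
From HB Require Import structures.
From mathcomp Require Import all_boot all_order all_algebra.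
From mathcomp Require Import all_classical all_reals all_analysis.
Import Order.TTheory GRing.Theory Num.Theory.
Import numFieldNormedType.Exports.

Set Implicit Arguments.
Unset Strict Implicit.
Unset Printing Implicit Defensive.

Local Open Scope classical_set_scope.
Local Open Scope ring_scope.

(* Grid functions on the uniform mesh x_i = i h (i <= N), y_j = j h (j <= M).
   Entry (i, j) of a matrix holds the value at
     (x_{i+1/2}, y_{j+1/2})  in 'M_(N, M)     (cell centers, V_c),
     (x_i,       y_{j+1/2})  in 'M_(N.+1, M)  (V_u),
     (x_{i+1/2}, y_j)        in 'M_(N, M.+1)  (V_v). *)
Section Mesh.
Context {R : realType} {N M : nat}.
Implicit Types (h : R) (c : 'M[R]_(N, M)).
Implicit Types (u : 'M[R]_(N.+1, M)) (v : 'M[R]_(N, M.+1)).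

(* For a node i : 'I_N.+1, [unlift ord0 i] is the cell i - 1 (None if i = 0)
   and [unlift ord_max i] is the cell i (None if i = N).  So the first branch
   is taken exactly for 1 <= i <= N - 1. *)
Definition dxc h c : 'M[R]_(N.+1, M) :=
  \matrix_(i, j)
    match unlift ord0 i, unlift ord_max i with
    | Some il, Some ir => (c ir j - c il j) / h
    | _, _ => 0
    end.

Definition dyc h c : 'M[R]_(N, M.+1) :=
  \matrix_(i, j)
    match unlift ord0 j, unlift ord_max j with
    | Some jl, Some jr => (c i jr - c i jl) / h
    | _, _ => 0
    end.

(* For a cell i : 'I_N, [lift ord0 i] is the node i + 1 and [lift ord_max i]
   is the node i. *)
Definition dxu h u : 'M[R]_(N, M) :=
  \matrix_(i, j) ((u (lift ord0 i) j - u (lift ord_max i) j) / h).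

Definition dyv h v : 'M[R]_(N, M) :=
  \matrix_(i, j) ((v i (lift ord0 j) - v i (lift ord_max j)) / h).

Definition ipc h c c' : R := h ^+ 2 * \sum_(i < N) \sum_(j < M) c i j * c' i j.

Definition ipu h u u' : R :=
  h ^+ 2 * \sum_(i < N.+1 | (0 < i < N)%N) \sum_(j < M) u i j * u' i j.

Definition ipv h v v' : R :=
  h ^+ 2 * \sum_(i < N) \sum_(j < M.+1 | (0 < j < M)%N) v i j * v' i j.

End Mesh.

Section PengRobinson.
Context {R : realType}.
(* Rg is the gas constant. *)
Implicit Types Rg T Tc Pc omega alpha beta lambda c : R.

(* [dec [:: d1; d2; ...]] is the decimal 0.d1d2...; numerals as large as 37464
   are avoided because they are unary. *)
Definition dec (ds : seq nat) : R := foldr (fun d r => (d%:R + r) / 10) 0 ds.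

(* 0.37464 + 1.54226 omega - 0.26992 omega^2  if omega <= 0.49, and otherwise
   0.379642 + 1.485030 omega - 0.164423 omega^2 + 0.016666 omega^3 *)
Definition pr_m omega : R :=
  if omega <= 49 / 100 then
    dec [:: 3; 7; 4; 6; 4] + (1 + dec [:: 5; 4; 2; 2; 6]) * omega
    - dec [:: 2; 6; 9; 9; 2] * omega ^+ 2
  else
    dec [:: 3; 7; 9; 6; 4; 2] + (1 + dec [:: 4; 8; 5; 0; 3; 0]) * omega
    - dec [:: 1; 6; 4; 4; 2; 3] * omega ^+ 2
    + dec [:: 0; 1; 6; 6; 6; 6] * omega ^+ 3.

Definition pr_alpha Rg T Tc Pc omega : R :=
  dec [:: 4; 5; 7; 2; 4] * (Rg ^+ 2 * Tc ^+ 2 / Pc)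
  * (1 + pr_m omega * (1 - Num.sqrt (T / Tc))) ^+ 2.

Definition pr_beta Rg Tc Pc : R := dec [:: 0; 7; 7; 8; 0] * (Rg * Tc / Pc).

Definition pr_log beta c : R :=
  ln ((1 + (1 - Num.sqrt 2) * beta * c) / (1 + (1 + Num.sqrt 2) * beta * c)).

Definition f_b (theta0 : R) Rg T alpha beta c : R :=
  c * theta0 + Rg * T * c * ln c - Rg * T * c * ln (1 - beta * c)
  + alpha * c / (2 * Num.sqrt 2 * beta) * pr_log beta c.

Definition G beta lambda c : R := Num.sqrt (lambda * c - c * ln (1 - beta * c)).

Definition nu Rg T beta lambda c : R :=
  Rg * T * (1 / c + (derive1 (G beta lambda) c) ^+ 2).

Definition mu_attraction alpha beta c : R :=
  alpha / (2 * Num.sqrt 2 * beta) * pr_log beta c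
  - alpha * c / (1 + 2 * beta * c - (beta * c) ^+ 2).

Definition s_r (theta0 : R) Rg T alpha beta lambda c : R :=
  - theta0 - Rg * T * ln c
  + Rg * T * ((derive1 (G beta lambda) c) ^+ 2 * c
              - 2 * G beta lambda c * derive1 (G beta lambda) c + lambda)
  - mu_attraction alpha beta c.

End PengRobinson.

(* [sup] and [inf] of a real set are 0 when the set is empty or unbounded.
   They are applied to functions continuous on a nonempty segment [a, b],
   where they are the maximum and the minimum. *)
Definition max_on {R : realType} (a b : R) (f : R -> R) : R :=
  sup [set f c | c in `[a, b]].

Definition min_on {R : realType} (a b : R) (f : R -> R) : R :=
  inf [set f c | c in `[a, b]].

Definition F_h {R : realType} {N M : nat}
    (h kappa theta0 Rg T alpha beta : R) (c : 'M[R]_(N, M)) : R :=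
  ipc h (map_mx (f_b theta0 Rg T alpha beta) c) (const_mx 1)
  + kappa / 2 * (ipu h (dxc h c) (dxc h c) + ipv h (dyc h c) (dyc h c)).

(* One step of the scheme, with the constant mu as part of the solution. *)
Definition scheme {R : realType} {N M : nat}
    (h kappa tau theta0 Rg T alpha beta lambda ct : R)
    (c0 c1 : 'M[R]_(N, M)) (mu : R) : Prop :=
  (forall i j,
     (c1 i j - c0 i j) / tau
     - kappa * (dxu h (dxc h c1) i j + dyv h (dyc h c1) i j)
     + nu Rg T beta lambda (c0 i j) * c1 i j
     = s_r theta0 Rg T alpha beta lambda (c0 i j) + mu)
  /\ ipc h c1 (const_mx 1) = ct.

(* Main.v *)
(* Write f_b(c) = theta0 c + RT c ln c + RT (G(c)^2 - lambda c) + f_attr(c).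
   From x = c^n to y = c^{n+1}, the functions c ln c, G^2 and f_attr increase by
   at most, respectively,
   (ln x + y/x)(y - x), because ln y <= ln x + y/x - 1;
   (G'(x)^2 (y - x) + 2 G(x) G'(x))(y - x), because the assumption on lambda
   makes G concave and 0 <= G(y) <= G(x) + G'(x)(y - x) can be squared;
   mu_attraction(x)(y - x), because f_attr is concave.
   Hence f_b(y) - f_b(x) <= (nu(x) y - s_r(x))(y - x).  The tangent bounds are
   available only on [cm, cM]; the bounds on mu and the equation at a cell where
   c^{n+1} is extremal keep c^{n+1} there.  After summation by parts, testing
   the scheme with c^{n+1} - c^n gives
   F_h(c^{n+1}) - F_h(c^n) <= <mu - (c^{n+1} - c^n)/tau, c^{n+1} - c^n>,
   where the constant mu drops out by conservation of mass. *)
Require Import Defs.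
From mathcomp Require Import all_boot all_order all_algebra.
From mathcomp Require Import all_classical all_reals all_analysis.
From mathcomp Require Import ring lra.
Import Order.TTheory GRing.Theory Num.Theory.
Import numFieldNormedType.Exports.
Local Open Scope ring_scope.

Set Implicit Arguments.
Unset Strict Implicit.

(** Two uses of the mean value theorem: on [df], to get that [df] is nonincreasing, then on [f],
    whose mean slope [df c] is compared with [df x] according to the sign of [y - x]. *)
Lemma concave_below_tangent {R : realType} (f df ddf : R -> R) (a b : R) :
  (forall x, x \in `[a, b] -> is_derive x 1 f (df x)) ->
  (forall x, x \in `[a, b] -> is_derive x 1 df (ddf x)) ->
  (forall x, x \in `[a, b] -> ddf x <= 0) ->
  forall x y, x \in `[a, b] -> y \in `[a, b] -> f y <= f x + df x * (y - x).
Proof.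
move=> fD dfD ddf_le0.
have mvt (g dg : R -> R) (u v : R) :
    (forall x, x \in `[a, b] -> is_derive x 1 g (dg x)) ->
    a <= u -> u <= v -> v <= b ->
    exists2 c, u <= c <= v & g v - g u = dg c * (v - u).
  move=> gD au uv vb.
  have gDuv x : x \in `[u, v] -> is_derive x 1 g (dg x).
    by rewrite in_itv/= => /andP[ux xv]; apply: gD; rewrite in_itv/=; lra.
  have gDoo x : x \in `]u, v[ -> is_derive x 1 g (dg x).
    by move=> xuv; apply: gDuv; exact: subset_itv_oo_cc.
  have gC : {within `[u, v], continuous g}%classic.
    by apply: derivable_within_continuous => x xuv; have [] := gDuv x xuv.
  have [c cuv E] := MVT_segment uv gDoo gC.
  by exists c => //; move: cuv; rewrite in_itv.
have df_nincr u v : a <= u -> u <= v -> v <= b -> df v <= df u.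
  move=> au uv vb; have [c /andP[uc cv] E] := mvt _ _ _ _ dfD au uv vb.
  have dc : ddf c <= 0 by apply: ddf_le0; rewrite in_itv/=; lra.
  by rewrite -subr_le0 E mulr_le0_ge0 ?subr_ge0.
move=> x y; rewrite !in_itv/= => /andP[ax xb] /andP[ay yb].
have [xy|/ltW yx] := leP x y.
- have [c /andP[xc cy] E] := mvt _ _ _ _ fD ax xy yb.
  by rewrite -lerBlDl E ler_wpM2r ?subr_ge0 ?df_nincr// (le_trans cy).
- have [c /andP[yc cx] E] := mvt _ _ _ _ fD ay yx xb.
  rewrite -lerBlDl -(opprB x) -(opprB (f x)) E mulrN lerN2.
  by rewrite ler_wpM2r ?subr_ge0 ?df_nincr// (le_trans ay).
Qed.

(** * Differentiation rules for pointwise expressions *)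

Section PointwiseDerivatives.
Context {R : realType}.
Implicit Types (f g : R -> R) (x k df dg : R).

Lemma is_derive1_cst k x : is_derive x 1 (fun=> k) 0.
Proof. exact: is_derive_cst. Qed.

Lemma is_derive1_id x : is_derive x 1 (fun y : R => y) 1.
Proof. exact: is_derive_id. Qed.

Lemma is_derive1_add {f g x df dg} :
  is_derive x 1 f df -> is_derive x 1 g dg ->
  is_derive x 1 (fun y => f y + g y) (df + dg).
Proof. exact: is_deriveD. Qed.

Lemma is_derive1_opp {f x df} :
  is_derive x 1 f df -> is_derive x 1 (fun y => - f y) (- df).
Proof. exact: is_deriveN. Qed.

Lemma is_derive1_mul {f g x df dg} :
  is_derive x 1 f df -> is_derive x 1 g dg ->
  is_derive x 1 (fun y => f y * g y) (f x * dg + g x * df).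
Proof. exact: is_deriveM. Qed.

Lemma is_derive1_sqr {f x df} :
  is_derive x 1 f df -> is_derive x 1 (fun y => f y ^+ 2) (2 * f x * df).
Proof.
move=> fD; have ffD := is_derive1_mul fD fD.
by apply: (is_derive_eq ffD); ring.
Qed.

Lemma is_derive1_inv {f x df} : f x != 0 ->
  is_derive x 1 f df -> is_derive x 1 (fun y => (f y)^-1) (- (f x) ^- 2 * df).
Proof. exact: is_deriveV. Qed.

Lemma is_derive1_lnf {f x df} : 0 < f x ->
  is_derive x 1 f df -> is_derive x 1 (fun y => ln (f y)) (df / f x).
Proof.
move=> fx0 fD; have lnD := is_derive1_ln fx0.
exact: (is_derive_eq (is_derive1_comp lnD fD) (mulrC _ _)).
Qed.

Lemma is_derive1_sqrtf {f x df} : 0 < f x ->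
  is_derive x 1 f df ->
  is_derive x 1 (fun y => Num.sqrt (f y)) (df / (2 * Num.sqrt (f x))).
Proof.
move=> fx0 fD; have sqrtD := is_derive1_sqrt fx0.
exact: (is_derive_eq (is_derive1_comp sqrtD fD) (mulrC _ _)).
Qed.

End PointwiseDerivatives.

(* [apply:] would let type class resolution pick other derivative rules. *)
Ltac derive_rec :=
  lazymatch goal with
  | |- is_derive _ _ (fun y => y) _ => exact: is_derive1_id
  | |- is_derive _ _ (fun=> ?k) _ => exact: (is_derive1_cst k)
  | |- is_derive _ _ (fun y => _ + _) _ =>
      notypeclasses refine (is_derive1_add _ _); derive_rec
  | |- is_derive _ _ (fun y => - _) _ =>
      notypeclasses refine (is_derive1_opp _); derive_rec
  | |- is_derive _ _ (fun y => _ * _) _ =>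
      notypeclasses refine (is_derive1_mul _ _); derive_rec
  (* The eta-contracted form of [fun y => k * y]. *)
  | |- is_derive _ _ ( *%R ?k) _ =>
      notypeclasses refine
        (is_derive1_mul (is_derive1_cst k _) (is_derive1_id _))
  | |- is_derive _ _ (fun y => _ ^+ 2) _ =>
      notypeclasses refine (is_derive1_sqr _); derive_rec
  | |- is_derive _ _ (fun y => _^-1) _ =>
      notypeclasses refine (is_derive1_inv _ _); [|derive_rec]
  | |- is_derive _ _ (fun y => ln _) _ =>
      notypeclasses refine (is_derive1_lnf _ _); [|derive_rec]
  | |- is_derive _ _ (fun y => Num.sqrt _) _ =>
      notypeclasses refine (is_derive1_sqrtf _ _); [|derive_rec]
  | |- _ => idtac
  end.

Ltac derive := notypeclasses refine (is_derive_eq _ _); [derive_rec|].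

(** * Derivatives and signs for [G] and the attraction energy *)

Section PengRobinsonEnergy.
Context {R : realType}.
Implicit Types (alpha beta lambda e x y : R).

Lemma ln_1_sub_le0 beta x : 0 <= beta * x -> ln (1 - beta * x) <= 0.
Proof. by move=> bx; rewrite ln_le0// gerBl. Qed.

Definition G2 beta lambda x := lambda * x - x * ln (1 - beta * x).

Definition dG2 beta lambda x :=
  lambda - ln (1 - beta * x) + beta * x / (1 - beta * x).

Definition dG beta lambda x :=
  dG2 beta lambda x / (2 * Num.sqrt (G2 beta lambda x)).

(** For [G = sqrt G2], [G'' = (2 G2 G2'' - G2'^2) / (4 G2^(3/2))], so the numerator carries the
    sign. *)
Definition ddG beta lambda x :=
  (2 * G2 beta lambda x * (beta / (1 - beta * x) + beta / (1 - beta * x) ^+ 2)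
   - dG2 beta lambda x ^+ 2)
  / (4 * Num.sqrt (G2 beta lambda x) ^+ 3).

Lemma G2_gt0 beta lambda x :
  0 < lambda -> 0 < x -> 0 <= beta * x -> 0 < G2 beta lambda x.
Proof.
move=> l0 x0 /ln_1_sub_le0 lnx.
by rewrite /G2 [lambda * x]mulrC -mulrBr mulr_gt0// subr_gt0 (le_lt_trans lnx).
Qed.

Lemma is_derive1_G2 beta lambda x : 0 < 1 - beta * x ->
  is_derive x 1 (G2 beta lambda) (dG2 beta lambda x).
Proof.
move=> h; have hn : 1 - beta * x != 0 by rewrite gt_eqF.
by rewrite /G2 /dG2; derive => //=; field.
Qed.

Lemma is_derive1_dG2 beta lambda x : 0 < 1 - beta * x ->
  is_derive x 1 (dG2 beta lambda)
    (beta / (1 - beta * x) + beta / (1 - beta * x) ^+ 2).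
Proof.
move=> h; have hn : 1 - beta * x != 0 by rewrite gt_eqF.
by rewrite /dG2; derive => //=; field.
Qed.

Lemma is_derive1_G beta lambda x :
  0 < lambda -> 0 < x -> 0 <= beta * x -> 0 < 1 - beta * x ->
  is_derive x 1 (G beta lambda) (dG beta lambda x).
Proof.
move=> l0 x0 bx0 bx1; apply: (is_derive1_sqrtf (f := G2 beta lambda)).
  exact: G2_gt0.
exact: is_derive1_G2.
Qed.

Lemma is_derive1_dG beta lambda x :
  0 < lambda -> 0 < x -> 0 <= beta * x -> 0 < 1 - beta * x ->
  is_derive x 1 (dG beta lambda) (ddG beta lambda x).
Proof.
move=> l0 x0 bx0 bx1; have g0 := G2_gt0 l0 x0 bx0.
have sg0 : Num.sqrt (G2 beta lambda x) != 0 by rewrite gt_eqF ?sqrtr_gt0.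
have gE : G2 beta lambda x = Num.sqrt (G2 beta lambda x) ^+ 2.
  by rewrite sqr_sqrtr// ltW.
rewrite /dG; notypeclasses refine (is_derive_eq _ _).
  notypeclasses refine (is_derive1_mul (is_derive1_dG2 lambda bx1) _).
  notypeclasses refine (is_derive1_inv _ _); last first.
    notypeclasses refine (is_derive1_mul (is_derive1_cst _ _) _).
    exact: (is_derive1_sqrtf g0 (is_derive1_G2 lambda bx1)).
  by rewrite mulf_neq0.
(* With the radicand written as the square of its root, [field] sees a rational identity in the
   single atom [s]. *)
rewrite /ddG [in 2 * G2 _ _ _]gE.
set s := Num.sqrt _ in sg0 *; set d := beta / _ + _.
by rewrite /=; field.
Qed.

(* With q = eps0 / (1 - eps0)^2 the assumption on [lambda] gives
   [lambda >= 2 q], and, for phi = lambda - ln (1 - b), b = beta * x, the sign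
   of G'' is that of 2 phi b / (1 - b)^2 - phi^2 - (b / (1 - b))^2. *)
Lemma ddG_le0 beta lambda e x :
  0 < lambda -> 2 * (e / (1 - e) ^+ 2) <= lambda ->
  0 < x -> 0 <= beta * x -> beta * x <= e -> e < 1 ->
  ddG beta lambda x <= 0.
Proof.
move=> l0 le x0 bx0 bxe e1; have g0 := G2_gt0 l0 x0 bx0.
have := ln_1_sub_le0 bx0.
rewrite /ddG pmulr_lle0; last first.
  by rewrite invr_gt0 mulr_gt0// exprn_gt0// sqrtr_gt0.
rewrite /G2 /dG2; set l := ln _ => l_le0.
set b := beta * x in bx0 bxe *.
have b1 : 1 - b != 0 by rewrite gt_eqF//; lra.
have -> : 2 * (lambda * x - x * l) * (beta / (1 - b) + beta / (1 - b) ^+ 2)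
    - (lambda - l + b / (1 - b)) ^+ 2
  = (lambda - l) * (2 * (b / (1 - b) ^+ 2) - (lambda - l)) - (b / (1 - b)) ^+ 2.
  by rewrite /b; field.
rewrite subr_le0 (le_trans _ (sqr_ge0 _))// mulr_ge0_le0//; first by lra.
(* [b / (1 - b)^2] increases on [[0, 1)]; with [l <= 0] the second factor is then at most
   [lambda - (lambda - l) <= 0]. *)
have bee : b / (1 - b) ^+ 2 <= e / (1 - e) ^+ 2.
  rewrite ler_pM// ?invr_ge0 ?sqr_ge0// lef_pV2 ?posrE ?exprn_gt0 ?subr_gt0//;
    last by rewrite (le_lt_trans bxe).
  rewrite lerXn2r// ?nnegrE ?subr_ge0 ?lerB//; first exact: ltW.
  by rewrite ltW// (le_lt_trans bxe).
lra.
Qed.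

Lemma ln_le_tangent x y : 0 < x -> 0 < y -> ln y <= ln x + (y - x) / x.
Proof.
move=> x0 y0; rewrite -lerBlDl -ln_div//.
have -> : y / x = 1 + (y - x) / x by field; rewrite gt_eqF.
apply: le_ln1Dx; rewrite mulrBl divff ?gt_eqF//.
by rewrite ltrBrDr addNr divr_gt0.
Qed.

Definition f_attr alpha beta x :=
  alpha * x / (2 * Num.sqrt 2 * beta) * pr_log beta x.

Definition pr_den beta x := 1 + 2 * beta * x - (beta * x) ^+ 2.

(** Since [(1 - sqrt 2) (1 + sqrt 2) = -1], the two linear factors inside [pr_log] multiply to the
    denominator of [mu_attraction]. *)
Lemma pr_denE beta x :
  (1 + (1 - Num.sqrt 2) * beta * x) * (1 + (1 + Num.sqrt 2) * beta * x)
  = pr_den beta x.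
Proof.
have s2 : Num.sqrt 2 ^+ 2 = 2 :> R by rewrite sqr_sqrtr.
transitivity (1 + 2 * beta * x + (1 - Num.sqrt 2 ^+ 2) * (beta * x) ^+ 2).
  by ring.
by rewrite s2 /pr_den; ring.
Qed.

Lemma is_derive1_pr_log beta x : 0 <= beta * x -> beta * x <= 1 ->
  is_derive x 1 (pr_log beta) (- (2 * Num.sqrt 2 * beta) / pr_den beta x).
Proof.
move=> bx0 bx1.
have s2 : Num.sqrt 2 ^+ 2 = 2 :> R by rewrite sqr_sqrtr.
have s0 : 0 <= Num.sqrt 2 :> R := sqrtr_ge0 _.
(* Gives [1 - sqrt 2 > -1], which keeps the numerator inside the logarithm positive up to
   [beta * x = 1]. *)
have sl2 : Num.sqrt 2 < 2 :> R by nra.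
rewrite -pr_denE /pr_log; set s := Num.sqrt 2 in s2 s0 sl2 *.
have v0 : 0 < 1 + (1 + s) * beta * x.
  by rewrite -mulrA ltr_pwDl// mulr_ge0// addr_ge0.
have u0 : 0 < 1 + (1 - s) * beta * x.
  rewrite -mulrA; nra.
have vn := lt0r_neq0 v0; have un := lt0r_neq0 u0.
derive => //=; first exact: divr_gt0.
by field; apply/andP.
Qed.

Lemma pr_den_gt0 beta x : 0 <= beta * x -> beta * x <= 1 -> 0 < pr_den beta x.
Proof. rewrite /pr_den -mulrA; nra. Qed.

Lemma is_derive1_f_attr alpha beta x : 0 < beta ->
  0 <= beta * x -> beta * x <= 1 ->
  is_derive x 1 (f_attr alpha beta) (mu_attraction alpha beta x).
Proof.
move=> b0 bx0 bx1.
have s0 : Num.sqrt 2 != 0 :> R by rewrite gt_eqF ?sqrtr_gt0.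
have d0 := lt0r_neq0 (pr_den_gt0 bx0 bx1).
have b0' := lt0r_neq0 b0.
rewrite /f_attr; notypeclasses refine (is_derive_eq _ _).
  notypeclasses refine (is_derive1_mul _ (is_derive1_pr_log bx0 bx1)).
  derive_rec.
rewrite /mu_attraction -/(pr_den beta x) /=.
set L := pr_log _ _; set D := pr_den _ _ in d0 *; set s := Num.sqrt 2 in s0 *.
by field; rewrite d0 b0' s0.
Qed.

(** The factor [1 + (beta x)^2] is [pr_den - x pr_den']. In this form the derivative is visibly
    nonpositive for [alpha >= 0], which makes [f_attr] concave. *)
Lemma is_derive1_mu_attraction alpha beta x : 0 < beta ->
  0 <= beta * x -> beta * x <= 1 ->
  is_derive x 1 (mu_attraction alpha beta)
    (- (alpha / pr_den beta x
        + alpha * (1 + (beta * x) ^+ 2) / pr_den beta x ^+ 2)).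
Proof.
move=> b0 bx0 bx1.
have s0 : Num.sqrt 2 != 0 :> R by rewrite gt_eqF ?sqrtr_gt0.
have d0 := lt0r_neq0 (pr_den_gt0 bx0 bx1).
have b0' := lt0r_neq0 b0.
rewrite /mu_attraction; notypeclasses refine (is_derive_eq _ _).
  notypeclasses refine (is_derive1_add _ _).
    notypeclasses refine
      (is_derive1_mul (is_derive1_cst _ _) (is_derive1_pr_log bx0 bx1)).
  by derive_rec.
rewrite /=; move: d0; rewrite /pr_den => d0.
by field; rewrite d0 b0' s0.
Qed.

End PengRobinsonEnergy.

(** * Extrema of [k nu - s_r] and the upper bound on [f_b] *)

Section EnergyBounds.
Context {R : realType}.
Implicit Types (a b x y : R) (f g : R -> R).

(** A [sup] bounds its set only if the set is bounded above; here the extreme value theorem supplies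
    the bound. It is applied to a differentiable [g] agreeing with [f] on the segment, because [f]
    will involve [derive1 G]. *)
Lemma le_max_on {a b f g x} :
  (forall c, c \in `[a, b] -> f c = g c) ->
  (forall c, c \in `[a, b] -> derivable g c 1) ->
  x \in `[a, b] -> f x <= max_on a b f.
Proof.
move=> fg gD xab; have ab : a <= b.
  by move: xab; rewrite in_itv/= => /andP[]; exact: le_trans.
have [m mab gm] := EVT_max ab (derivable_within_continuous gD).
apply: ub_le_sup; last by exists x.
exists (g m) => _ [c cab <-].
by rewrite (fg _ cab); exact: gm.
Qed.

Lemma min_on_le {a b f g x} :
  (forall c, c \in `[a, b] -> f c = g c) ->
  (forall c, c \in `[a, b] -> derivable g c 1) ->
  x \in `[a, b] -> min_on a b f <= f x.
Proof.
move=> fg gD xab; have ab : a <= b.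
  by move: xab; rewrite in_itv/= => /andP[]; exact: le_trans.
have [m mab gm] := EVT_min ab (derivable_within_continuous gD).
apply: ge_inf; last by exists x.
exists (g m) => _ [c cab <-].
by rewrite (fg _ cab); exact: gm.
Qed.

Variables (theta0 Rg T alpha beta lambda cm cM e : R).
Hypotheses (RT0 : 0 < Rg * T) (alpha0 : 0 <= alpha) (beta0 : 0 < beta).
Hypotheses (lambda0 : 0 < lambda) (lambdaE : 2 * (e / (1 - e) ^+ 2) <= lambda).
Hypotheses (cm0 : 0 < cm) (cMe : beta * cM <= e) (e1 : e < 1).

Lemma itv_range x : x \in `[cm, cM] ->
  [/\ 0 < x, 0 <= beta * x, beta * x <= e & 0 < 1 - beta * x].
Proof.
rewrite in_itv/= => /andP[cmx xcM].
have x0 := lt_le_trans cm0 cmx.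
have bxe : beta * x <= e by rewrite (le_trans _ cMe)// ler_pM2l.
split=> //; first by rewrite mulr_ge0// ltW.
by rewrite subr_gt0 (le_lt_trans bxe).
Qed.

Lemma derive1_G x : x \in `[cm, cM] ->
  derive1 (G beta lambda) x = dG beta lambda x.
Proof.
move=> /itv_range[x0 bx0 _ bx1]; rewrite derive1E.
by have [] := is_derive1_G lambda0 x0 bx0 bx1.
Qed.

(** [k nu - s_r] with the closed form [dG] in place of [derive1 G], so that the differentiation
    rules apply. *)
Let gap k x := k * (Rg * T * (x^-1 + dG beta lambda x ^+ 2))
  - (- theta0 - Rg * T * ln x
     + Rg * T * (dG beta lambda x ^+ 2 * x
                 - 2 * G beta lambda x * dG beta lambda x + lambda)
     - mu_attraction alpha beta x).

Lemma nu_s_rE k x : x \in `[cm, cM] ->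
  k * nu Rg T beta lambda x - s_r theta0 Rg T alpha beta lambda x = gap k x.
Proof. by move=> xab; rewrite /gap /nu /s_r derive1_G// div1r. Qed.

Lemma derivable_gap k x : x \in `[cm, cM] -> derivable (gap k) x 1.
Proof.
move=> /itv_range[x0 bx0 bxe bx1].
have GD := is_derive1_G lambda0 x0 bx0 bx1.
have dGD := is_derive1_dG lambda0 x0 bx0 bx1.
have muD := is_derive1_mu_attraction alpha beta0 bx0 (le_trans bxe (ltW e1)).
(* The value of the derivative stays an existential variable, filled in by the rules. *)
rewrite /gap; notypeclasses refine (@ex_derive _ _ _ _ _ _ _ _); derive_rec.
all: first [exact: GD | exact: dGD | exact: muD | exact: (is_derive1_ln x0)
           | exact: (is_derive1_inv (lt0r_neq0 x0) (is_derive1_id x))].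
Qed.

Lemma le_max_on_nu_s_r k x : x \in `[cm, cM] ->
  k * nu Rg T beta lambda x - s_r theta0 Rg T alpha beta lambda x
  <= max_on cm cM (fun c => k * nu Rg T beta lambda c
                            - s_r theta0 Rg T alpha beta lambda c).
Proof.
move=> xab; exact: (le_max_on (nu_s_rE k) (@derivable_gap k) xab).
Qed.

Lemma min_on_nu_s_r_le k x : x \in `[cm, cM] ->
  min_on cm cM (fun c => k * nu Rg T beta lambda c
                         - s_r theta0 Rg T alpha beta lambda c)
  <= k * nu Rg T beta lambda x - s_r theta0 Rg T alpha beta lambda x.
Proof.
move=> xab; exact: (min_on_le (nu_s_rE k) (@derivable_gap k) xab).
Qed.

Lemma nu_gt0 x : x \in `[cm, cM] -> 0 < nu Rg T beta lambda x.
Proof.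
move=> /itv_range[x0 _ _ _]; rewrite /nu mulr_gt0// ltr_pwDl ?sqr_ge0//.
exact: divr_gt0.
Qed.

(** As [nu(x) x - s_r(x) = f_b'(x)], the bound is the tangent increment plus [nu(x) (y - x)^2]. Its
    first factor is affine in [y] and is the potential that the scheme uses. *)
Lemma f_b_le_tangent x y : x \in `[cm, cM] -> y \in `[cm, cM] ->
  f_b theta0 Rg T alpha beta y - f_b theta0 Rg T alpha beta x
  <= (nu Rg T beta lambda x * y - s_r theta0 Rg T alpha beta lambda x)
     * (y - x).
Proof.
move=> xab yab.
have [x0 bx0 bxe bx1] := itv_range xab.
have [y0 by0 bye by1] := itv_range yab.
have bE z : f_b theta0 Rg T alpha beta z =
    z * theta0 + Rg * T * (z * ln z)
    + Rg * T * (G2 beta lambda z - lambda * z) + f_attr alpha beta z.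
  by rewrite /f_b /G2 /f_attr; ring.
have logineq : y * ln y - x * ln x <= (ln x + y / x) * (y - x).
  have := ln_le_tangent x0 y0; rewrite -(ler_pM2l y0) => lny.
  have -> : (ln x + y / x) * (y - x)
      = y * (ln x + (y - x) / x) - x * ln x by field; rewrite gt_eqF.
  by rewrite lerB.
have Gineq : G2 beta lambda y - G2 beta lambda x <=
    (dG beta lambda x ^+ 2 * (y - x) + 2 * G beta lambda x * dG beta lambda x)
    * (y - x).
  have sqG z : 0 < z -> 0 <= beta * z ->
      G2 beta lambda z = G beta lambda z ^+ 2.
    by move=> z0 bz0; rewrite /G -/(G2 _ _ _) sqr_sqrtr// ltW// G2_gt0.
  have Gle : G beta lambda y <= G beta lambda x + dG beta lambda x * (y - x).
    apply: (concave_below_tangent (ddf := ddG beta lambda) _ _ _ xab yab).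
    - by move=> z /itv_range[z0 bz0 _ bz1]; exact: is_derive1_G.
    - by move=> z /itv_range[z0 bz0 _ bz1]; exact: is_derive1_dG.
    - by move=> z /itv_range[z0 bz0 bze _]; exact: (ddG_le0 _ lambdaE).
  have G0 : 0 <= G beta lambda y := sqrtr_ge0 _.
  rewrite !sqG// lerBlDr.
  have -> : (dG beta lambda x ^+ 2 * (y - x)
             + 2 * G beta lambda x * dG beta lambda x) * (y - x)
      + G beta lambda x ^+ 2
    = (G beta lambda x + dG beta lambda x * (y - x)) ^+ 2 by ring.
  by rewrite lerXn2r// nnegrE// (le_trans G0).
have attrineq : f_attr alpha beta y <=
    f_attr alpha beta x + mu_attraction alpha beta x * (y - x).
  apply: (concave_below_tangent _ _ _ xab yab).
  - move=> z /itv_range[z0 bz0 bze _].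
    exact: (is_derive1_f_attr _ _ _ (le_trans bze (ltW e1))).
  - move=> z /itv_range[z0 bz0 bze _].
    exact: (is_derive1_mu_attraction _ _ _ (le_trans bze (ltW e1))).
  - move=> z /itv_range[z0 bz0 bze _].
    have d0 := pr_den_gt0 bz0 (le_trans bze (ltW e1)).
    have d0' := ltW d0.
    rewrite oppr_le0 addr_ge0// divr_ge0 ?sqr_ge0// mulr_ge0//.
    by rewrite addr_ge0 ?sqr_ge0.
rewrite !bE /nu /s_r derive1_G//.
(* The slacks of the three bounds, the first two scaled by [Rg * T], add up exactly to the slack of
   the goal. *)
rewrite -(ler_pM2l RT0) in logineq; rewrite -(ler_pM2l RT0) in Gineq.
rewrite -subr_ge0 in logineq; rewrite -subr_ge0 in Gineq.
rewrite -subr_ge0 in attrineq; rewrite -subr_ge0.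
apply: le_trans (addr_ge0 (addr_ge0 logineq Gineq) attrineq) _.
by rewrite le_eqVlt; apply/orP; left; apply/eqP; field; rewrite gt_eqF.
Qed.

End EnergyBounds.

(** * Differences and summation by parts along one grid line *)

Section Mesh1D.
Context {R : realType} {N : nat}.
Implicit Types (h : R) (f g : 'I_N -> R) (i : 'I_N) (k : 'I_N.+1).

Definition node_diff h f k : R :=
  match unlift ord0 k, unlift ord_max k with
  | Some l, Some r => (f r - f l) / h
  | _, _ => 0
  end.

(** The one-dimensional Neumann Laplacian. *)
Definition cell_lap h f i : R :=
  (node_diff h f (lift ord0 i) - node_diff h f (lift ord_max i)) / h.

Lemma node_diffB h f g k :
  node_diff h (fun i => f i - g i) k = node_diff h f k - node_diff h g k.
Proof.
rewrite /node_diff; case: (unlift ord0 k) => [l|]; rewrite ?subr0//.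
by case: (unlift ord_max k) => [r|]; rewrite ?subr0//; ring.
Qed.

(** At a minimum the right difference is nonnegative and the left one nonpositive, so 0 separates
    them; a boundary node has the value 0. *)
Lemma cell_lap_ge0 h f i : 0 < h -> (forall j, f i <= f j) ->
  0 <= cell_lap h f i.
Proof.
move=> h0 fmin; rewrite divr_ge0 ?(ltW h0)// subr_ge0 /node_diff !liftK.
apply: (@le_trans _ _ 0); case: (unlift _ _) => // j.
  by rewrite pmulr_lle0 ?invr_gt0// subr_le0.
by rewrite divr_ge0 ?(ltW h0)// subr_ge0.
Qed.

Lemma cell_lap_le0 h f i : 0 < h -> (forall j, f j <= f i) ->
  cell_lap h f i <= 0.
Proof.
move=> h0 fmax; rewrite pmulr_lle0 ?invr_gt0// subr_le0 /node_diff !liftK.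
apply: (@le_trans _ _ 0); case: (unlift _ _) => // j.
  by rewrite pmulr_lle0 ?invr_gt0// subr_le0.
by rewrite divr_ge0 ?(ltW h0)// subr_ge0.
Qed.

(** The differences vanish at the nodes 0 and [N]. The sum over all nodes can then be reindexed
    through [lift]. *)
Lemma sum_inner_nodes h f g :
  \sum_(k < N.+1 | (0 < k < N)%N) node_diff h f k * node_diff h g k
  = \sum_k node_diff h f k * node_diff h g k.
Proof.
rewrite [LHS]big_mkcond; apply: eq_bigr => k _; case: ifPn => // kb.
suff -> : node_diff h f k = 0 by rewrite mul0r.
move: kb; rewrite negb_and -eqn0Ngt -leqNgt /node_diff => /orP[/eqP k0|Nk].
- have -> : k = ord0 by exact: val_inj.
  by rewrite unlift_none.
- have -> : k = ord_max.
    by apply: val_inj; apply/eqP; rewrite eqn_leq Nk -ltnS ltn_ord.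
  by rewrite unlift_none; case: (unlift _ _).
Qed.

Lemma sum_by_parts h f g :
  \sum_(k < N.+1 | (0 < k < N)%N) node_diff h f k * node_diff h g k
  = - \sum_i cell_lap h f i * g i.
Proof.
rewrite sum_inner_nodes.
pose D := node_diff h f.
(* At a boundary node [D k = 0], so the default 0 for the missing cell does no harm. *)
have DgE k : D k * node_diff h g k
    = (D k * oapp g 0 (unlift ord_max k) - D k * oapp g 0 (unlift ord0 k)) / h.
  rewrite /D /node_diff; case: (unlift ord0 k) => [l|];
    case: (unlift ord_max k) => [r|] /=; ring.
(* Without the node [p], which has no cell on the relevant side, the nodes are the [lift p i], one
   for each cell. *)
have sumE (p : 'I_N.+1) : \sum_k D k * oapp g 0 (unlift p k)
    = \sum_i D (lift p i) * g i.
  rewrite (bigD1_ord p)//= unlift_none mulr0 add0r.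
  by apply: eq_bigr => i _; rewrite liftK.
rewrite (eq_bigr _ (fun k _ => DgE k)) -mulr_suml sumrB !sumE -sumrB mulr_suml.
by rewrite -sumrN; apply: eq_bigr => i _; rewrite /cell_lap -/D; ring.
Qed.

End Mesh1D.

(** * Discrete Green formula and extremal cells in two dimensions *)

Section Mesh2D.
Context {R : realType} {N M : nat}.
Implicit Types (h : R) (c d : 'M[R]_(N, M)).

Lemma dxcE h c k j : dxc h c k j = node_diff h (fun i => c i j) k.
Proof. by rewrite mxE. Qed.

Lemma dycE h c i k : dyc h c i k = node_diff h (c i) k.
Proof. by rewrite mxE. Qed.

Lemma dxu_dxcE h c i j : dxu h (dxc h c) i j = cell_lap h (fun i => c i j) i.
Proof. by rewrite mxE !dxcE. Qed.

Lemma dyv_dycE h c i j : dyv h (dyc h c) i j = cell_lap h (c i) j.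
Proof. by rewrite mxE !dycE. Qed.

(** Summation by parts on every grid line of each direction; the Neumann condition removes the
    boundary terms. *)
Lemma dirichlet_by_parts h c d :
  ipu h (dxc h c) (dxc h d) + ipv h (dyc h c) (dyc h d)
  = - (h ^+ 2 * \sum_i \sum_j
         (dxu h (dxc h c) i j + dyv h (dyc h c) i j) * d i j).
Proof.
have xE : ipu h (dxc h c) (dxc h d)
    = - (h ^+ 2 * \sum_i \sum_j dxu h (dxc h c) i j * d i j).
  rewrite /ipu exchange_big/= -mulrN [in RHS]exchange_big/= -sumrN.
  congr (_ * _); apply: eq_bigr => j _.
  under eq_bigr do rewrite !dxcE.
  rewrite sum_by_parts; congr (- _).
  by apply: eq_bigr => i _; rewrite dxu_dxcE.
have yE : ipv h (dyc h c) (dyc h d)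
    = - (h ^+ 2 * \sum_i \sum_j dyv h (dyc h c) i j * d i j).
  rewrite /ipv -mulrN -sumrN; congr (_ * _); apply: eq_bigr => i _.
  under eq_bigr do rewrite !dycE.
  rewrite sum_by_parts; congr (- _).
  by apply: eq_bigr => j _; rewrite dyv_dycE.
rewrite xE yE -opprD -mulrDr -big_split/=; congr (- (_ * _)).
apply: eq_bigr => i _; rewrite -big_split/=.
by apply: eq_bigr => j _; rewrite mulrDl.
Qed.

(* [a^2 - b^2 <= 2 a (a - b)] at every node. *)
Lemma dirichlet_diff_le h c d :
  (ipu h (dxc h c) (dxc h c) + ipv h (dyc h c) (dyc h c)
   - (ipu h (dxc h d) (dxc h d) + ipv h (dyc h d) (dyc h d))) / 2
  <= - (h ^+ 2 * \sum_i \sum_j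
         (dxu h (dxc h c) i j + dyv h (dyc h c) i j) * (c i j - d i j)).
Proof.
(* The increment is read as the grid function [c - d], so that the Green formula applies. *)
have -> : \sum_i \sum_j
     (dxu h (dxc h c) i j + dyv h (dyc h c) i j) * (c i j - d i j)
  = \sum_i \sum_j
     (dxu h (dxc h c) i j + dyv h (dyc h c) i j) * (c - d) i j.
  by apply: eq_bigr => i _; apply: eq_bigr => j _; rewrite !mxE.
rewrite -dirichlet_by_parts ler_pdivrMr//.
have sq (a b : R) : a * a - b * b <= (a * (a - b)) * 2.
  by rewrite -subr_ge0 (_ : _ - _ = (a - b) ^+ 2) ?sqr_ge0//; ring.
rewrite opprD addrACA mulrDl; apply: lerD.
- rewrite /ipu; move: (h ^+ 2) (sqr_ge0 h) => h2 h2_ge0.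
  rewrite -mulrBr -mulrA ler_wpM2l// -sumrB mulr_suml ler_sum//.
  move=> k _; rewrite -sumrB mulr_suml ler_sum// => j _.
  rewrite !dxcE; have -> : node_diff h (fun i => (c - d) i j) k
      = node_diff h (fun i => c i j) k - node_diff h (fun i => d i j) k.
    rewrite -node_diffB; congr node_diff.
    by apply/funext => i; rewrite !mxE.
  exact: sq.
- rewrite /ipv; move: (h ^+ 2) (sqr_ge0 h) => h2 h2_ge0.
  rewrite -mulrBr -mulrA ler_wpM2l// -sumrB mulr_suml ler_sum//.
  move=> i _; rewrite -sumrB mulr_suml ler_sum// => k _.
  rewrite !dycE; have -> : node_diff h ((c - d) i) k
      = node_diff h (c i) k - node_diff h (d i) k.
    rewrite -node_diffB; congr node_diff.
    by apply/funext => j; rewrite !mxE.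
  exact: sq.
Qed.

(** A global minimum is a minimum along both grid lines through it. The given cell shows that the
    mesh is nonempty. *)
Lemma exists_min_cell h c (i : 'I_N) (j : 'I_M) : 0 < h ->
  exists i0 j0, (forall i j, c i0 j0 <= c i j) /\
    0 <= dxu h (dxc h c) i0 j0 + dyv h (dyc h c) i0 j0.
Proof.
move=> h0; pose F (p : 'I_N * 'I_M) := c p.1 p.2.
have [[i0 j0] _ cmin] := @arg_minP _ _ _ (i, j) predT F isT.
exists i0, j0; split=> [k l|]; first exact: (cmin (k, l)).
rewrite dxu_dxcE dyv_dycE addr_ge0// cell_lap_ge0// => k.
- exact: (cmin (k, j0)).
- exact: (cmin (i0, k)).
Qed.

Lemma exists_max_cell h c (i : 'I_N) (j : 'I_M) : 0 < h ->
  exists i0 j0, (forall i j, c i j <= c i0 j0) /\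
    dxu h (dxc h c) i0 j0 + dyv h (dyc h c) i0 j0 <= 0.
Proof.
move=> h0; pose F (p : 'I_N * 'I_M) := c p.1 p.2.
have [[i0 j0] _ cmax] := @arg_maxP _ _ _ (i, j) predT F isT.
exists i0, j0; split=> [k l|]; first exact: (cmax (k, l)).
rewrite dxu_dxcE dyv_dycE; rewrite -[leRHS]addr0 lerD// cell_lap_le0// => k.
- exact: (cmax (k, j0)).
- exact: (cmax (i0, k)).
Qed.

End Mesh2D.

(** * Maximum principle and energy decay *)

Section Scheme.
Context {R : realType}.

Lemma dec_ge0 (ds : seq nat) : 0 <= dec ds :> R.
Proof. by elim: ds => //= d ds IH; rewrite divr_ge0// addr_ge0. Qed.

(** As [ln (1 - e) <= 0], the radicand is at least [s^2], so the root is at least [s]. *)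
Lemma lambda_ge (e lambda : R) : 0 <= e -> e < 1 ->
  e / (1 - e) ^+ 2
  + Num.sqrt (e ^+ 2 / (1 - e) ^+ 4 - 2 * ln (1 - e) * (e / (1 - e) ^+ 2))
    <= lambda ->
  2 * (e / (1 - e) ^+ 2) <= lambda.
Proof.
move=> e0 e1; apply: le_trans; set s := e / (1 - e) ^+ 2.
have s0 : 0 <= s by rewrite divr_ge0 ?sqr_ge0.
rewrite mulr_natl mulr2n lerD2l -{1}(ger0_norm s0) -sqrtr_sqr ler_wsqrtr//.
have -> : e ^+ 2 / (1 - e) ^+ 4 = s ^+ 2.
  by rewrite /s; field; rewrite gt_eqF// subr_gt0.
rewrite lerDl oppr_ge0 mulr_le0_ge0// mulr_ge0_le0// ln_le0//.
by rewrite gerBl.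
Qed.

Context {N M : nat}.
Variables (h kappa tau theta0 Rg T alpha beta lambda ct : R).
Variables (cm cM e mu : R) (c0 c1 : 'M[R]_(N, M)).
Hypotheses (h0 : 0 < h) (kappa0 : 0 < kappa) (tau0 : 0 < tau).
Hypotheses (RT0 : 0 < Rg * T) (alpha0 : 0 <= alpha) (beta0 : 0 < beta).
Hypotheses (lambda0 : 0 < lambda) (lambdaE : 2 * (e / (1 - e) ^+ 2) <= lambda).
Hypotheses (cm0 : 0 < cm) (cMe : beta * cM <= e) (e1 : e < 1).
Hypothesis c0_range : forall i j, cm <= c0 i j <= cM.
Hypothesis c1_scheme :
  scheme h kappa tau theta0 Rg T alpha beta lambda ct c0 c1 mu.
Local Notation nu := (nu Rg T beta lambda).
Local Notation s_r := (s_r theta0 Rg T alpha beta lambda).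
Hypothesis mu_lo : max_on cm cM (fun c => cm * nu c - s_r c) <= mu.
Hypothesis mu_hi : mu <= min_on cm cM (fun c => cM * nu c - s_r c).

(** At a minimal cell the scheme reads [(1/tau + nu) (c1 - cm) = (c0 - cm)/tau + kappa lap + (mu -
    (cm nu - s_r))], with [nu] and [s_r] taken at [c0], and all three terms on the right are
    nonnegative. A maximal cell is treated symmetrically with [cM]. *)
Lemma maximum_principle i j : cm <= c1 i j <= cM.
Proof.
have tauV0 : 0 < tau^-1 by rewrite invr_gt0.
have [schemeE _] := c1_scheme; apply/andP; split.
- have [i0 [j0 [cmin lap0]]] := exists_min_cell c1 i j h0.
  apply: le_trans (cmin i j).
  have cab : c0 i0 j0 \in `[cm, cM] by rewrite in_itv/= c0_range.
  have nu0 : 0 < tau^-1 + nu (c0 i0 j0).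
    by rewrite addr_gt0// (nu_gt0 _ RT0 beta0 cm0 cMe e1).
  have := le_trans (le_max_on_nu_s_r theta0 Rg T alpha beta0 lambda0
    cm0 cMe e1 cm cab) mu_lo.
  have /andP[c0m _] := c0_range i0 j0.
  have := mulr_ge0 (ltW tauV0) (_ : 0 <= c0 i0 j0 - cm).
  rewrite subr_ge0 => /(_ c0m) ? ?.
  have := mulr_ge0 (ltW kappa0) lap0 => ?.
  have := schemeE i0 j0 => ?.
  rewrite -subr_ge0 -(pmulr_rge0 _ nu0); lra.
- have [i0 [j0 [cmax lap0]]] := exists_max_cell c1 i j h0.
  apply: le_trans (cmax i j) _.
  have cab : c0 i0 j0 \in `[cm, cM] by rewrite in_itv/= c0_range.
  have nu0 : 0 < tau^-1 + nu (c0 i0 j0).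
    by rewrite addr_gt0// (nu_gt0 _ RT0 beta0 cm0 cMe e1).
  have := le_trans mu_hi (min_on_nu_s_r_le theta0 Rg T alpha beta0 lambda0
    cm0 cMe e1 cM cab).
  have /andP[_ c0M] := c0_range i0 j0.
  have := mulr_ge0 (ltW tauV0) (_ : 0 <= cM - c0 i0 j0).
  rewrite subr_ge0 => /(_ c0M) ? ?.
  have := mulr_ge0_le0 (ltW kappa0) lap0 => ?.
  have := schemeE i0 j0 => ?.
  rewrite -subr_ge0 -(pmulr_rge0 _ nu0); lra.
Qed.

Lemma ipc_const_mx1 (c : 'M[R]_(N, M)) :
  ipc h c (const_mx 1) = h ^+ 2 * \sum_i \sum_j c i j.
Proof.
congr (_ * _); apply: eq_bigr => i _; apply: eq_bigr => j _.
by rewrite mxE mulr1.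
Qed.

Lemma energy_decay : ipc h c0 (const_mx 1) = ct ->
  F_h h kappa theta0 Rg T alpha beta c1
    <= F_h h kappa theta0 Rg T alpha beta c0.
Proof.
move=> c0_mass; have [schemeE c1_mass] := c1_scheme.
pose lap i j := dxu h (dxc h c1) i j + dyv h (dyc h c1) i j.
pose fb := f_b theta0 Rg T alpha beta.
have dirE := dirichlet_diff_le h c1 c0.
rewrite -(ler_pM2l kappa0) in dirE.
have bulkE : h ^+ 2 * \sum_i \sum_j (fb (c1 i j) - fb (c0 i j)) <=
    h ^+ 2 * \sum_i \sum_j
      (nu (c0 i j) * c1 i j - s_r (c0 i j)) * (c1 i j - c0 i j).
  rewrite ler_wpM2l ?sqr_ge0// ler_sum// => i _; rewrite ler_sum// => j _.
  apply: (f_b_le_tangent _ RT0 alpha0 beta0 lambda0 lambdaE cm0 cMe e1).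
  - by rewrite in_itv/= c0_range.
  - by rewrite in_itv/= maximum_principle.
have massE : h ^+ 2 * \sum_i \sum_j (c1 i j - c0 i j) = 0.
  under eq_bigr do rewrite sumrB.
  by rewrite sumrB mulrBr -!ipc_const_mx1 c1_mass c0_mass subrr.
have potE : h ^+ 2 * (\sum_i \sum_j
      (nu (c0 i j) * c1 i j - s_r (c0 i j)) * (c1 i j - c0 i j))
    + kappa * - (h ^+ 2 * \sum_i \sum_j lap i j * (c1 i j - c0 i j)) <= 0.
  (* [mu] is the same in every cell, so it factors out of the sum and multiplies the change of
     mass. *)
  apply: (@le_trans _ _ (mu * (h ^+ 2 * \sum_i \sum_j (c1 i j - c0 i j))));
    last by rewrite massE mulr0.
  rewrite mulrN !(mulrCA _ (h ^+ 2)) -mulrBr.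
  rewrite ler_wpM2l ?sqr_ge0// !mulr_sumr -sumrB ler_sum// => i _.
  rewrite !mulr_sumr -sumrB ler_sum// => j _.
  (* Substituting the scheme leaves the surplus [- (c1 - c0)^2 / tau], nonpositive for every
     [tau > 0]. *)
  rewrite [leLHS](_ : _ = mu * (c1 i j - c0 i j)
      - (c1 i j - c0 i j) ^+ 2 / tau).
    by rewrite gerBl// divr_ge0 ?sqr_ge0// ltW.
  have -> : mu = (c1 i j - c0 i j) / tau - kappa * lap i j
      + nu (c0 i j) * c1 i j - s_r (c0 i j)
    by rewrite schemeE addrAC subrr add0r.
  by field; rewrite gt_eqF.
have FE (c : 'M[R]_(N, M)) : F_h h kappa theta0 Rg T alpha beta c =
    h ^+ 2 * (\sum_i \sum_j fb (c i j))
    + kappa * ((ipu h (dxc h c) (dxc h c) + ipv h (dyc h c) (dyc h c)) / 2).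
  rewrite /F_h ipc_const_mx1; congr (_ * _ + _); last by rewrite mulrA mulrAC.
  by apply: eq_bigr => i _; apply: eq_bigr => j _; rewrite mxE.
rewrite -subr_le0 !FE opprD addrACA -!mulrBr -mulrBl -sumrB.
under eq_bigr do rewrite -sumrB.
exact: le_trans (lerD bulkE dirE) potE.
Qed.

End Scheme.

(** * Signs of the physical constants, and conclusion *)

Theorem theorem5p3 (R : realType) (N M : nat) (lx ly h : R)
  (hlx : 0 < lx) (hly : 0 < ly)
  (hx : lx = N%:R * h) (hy : ly = M%:R * h)
  (kappa ct theta0 Rg T Tc Pc omega alpha beta : R)
  (hkappa : 0 < kappa) (hct : 0 < ct) (hRg : 0 < Rg) (hT : 0 < T)
  (hTc : 0 < Tc) (hPc : 0 < Pc)
  (halpha : alpha = pr_alpha Rg T Tc Pc omega)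
  (hbeta : beta = pr_beta Rg Tc Pc)
  (cm cM eps0 lambda : R)
  (hcm : 0 < cm) (hcmM : cm <= cM)
  (hbcM : beta * cM <= eps0) (heps0 : eps0 < 1)
  (hlambda0 : 0 < lambda)
  (hlambda : eps0 / (1 - eps0) ^+ 2
      + Num.sqrt (eps0 ^+ 2 / (1 - eps0) ^+ 4
                  - 2 * ln (1 - eps0) * (eps0 / (1 - eps0) ^+ 2)) <= lambda)
  (tau : R) (htau : 0 < tau)
  (c0 : 'M[R]_(N, M))
  (hc0 : forall i j, cm <= c0 i j <= cM)
  (hc0t : ipc h c0 (const_mx 1) = ct)
  (c1 : 'M[R]_(N, M)) (mu : R)
  (hscheme : scheme h kappa tau theta0 Rg T alpha beta lambda ct c0 c1 mu)
  (hmu_lo : max_on cm cM (fun c => cm * nu Rg T beta lambda c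
                           - s_r theta0 Rg T alpha beta lambda c) <= mu)
  (hmu_hi : mu <= min_on cm cM (fun c => cM * nu Rg T beta lambda c
                           - s_r theta0 Rg T alpha beta lambda c)) :
  F_h h kappa theta0 Rg T alpha beta c1
    <= F_h h kappa theta0 Rg T alpha beta c0.
Proof.
have h0 : 0 < h.
  rewrite ltNge; apply/negP => h_le0; move: hlx.
  by rewrite hx ltNge mulr_ge0_le0.
have RTP : 0 < Rg * Tc / Pc by rewrite divr_gt0// mulr_gt0.
have beta0 : 0 < beta.
  by rewrite hbeta /pr_beta mulr_gt0// /dec /=; lra.
(* The squared bracket in [pr_alpha] may vanish, so the inequality is not strict. *)
have alpha0 : 0 <= alpha.
  rewrite halpha /pr_alpha mulr_ge0 ?sqr_ge0// mulr_ge0 ?dec_ge0//.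
  by rewrite divr_ge0 ?mulr_ge0 ?sqr_ge0// ltW.
(* From [0 < beta * cM <= eps0]. *)
have e0 : 0 <= eps0.
  by rewrite (le_trans _ hbcM)// mulr_ge0 ?ltW// (lt_le_trans hcm).
have lambdaE := lambda_ge e0 heps0 hlambda.
exact: (energy_decay h0 hkappa htau (mulr_gt0 hRg hT) alpha0 beta0 hlambda0
  lambdaE hcm hbcM heps0 hc0 hscheme hmu_lo hmu_hi hc0t).
Qed.
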